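(* Let $G$ be a combinatorial model for the metric graph $\Gamma$, with associated matrices $\mathbf V$ and $\mathbf Q$. For any $e\in E(G)$, let $\widetilde{\mathbf V}$ and $\widetilde{\mathbf Q}$ be the matrices obtained by changing the orientation of $e$. Then $\widetilde{\mathbf V}=\mathbf V$ and $\widetilde{\mathbf Q}=\mathbf Q$.
   Context: Graphs. A combinatorial graph $G$ is a finite directed multigraph (loops and multiple edges allowed) with vertices $p_1,\dots,p_{n_G}$ and edges $e_1,\dots,e_{m_G}$; each edge $e$ has an initial vertex $e_-$ and a terminal vertex $e_+$, and changing its orientation swaps these. A metric graph $\Gamma$ is a compact topological graph with a length metric. A combinatorial model of $\Gamma$ is a combinatorial graph $G$ with edge lengths $\ell:E(G)\to\mathbb R_{>0}$ such that gluing intervals $[0,\ell(e)]$ along the vertices yields $\Gamma$ isometrically. All graphs are connected and every point has valence at least $2$. The genus is $g=m_G-n_G+1$. Matrices. For a 1-chain $\alpha$, $\alpha(e)$ is its coefficient at $e$. Fix a spanning tree $\mathrm{ST}$ of $G$ with root $q=p_1$. Adding any one of the $g$ edges outside $\mathrm{ST}$ to $\mathrm{ST}$ generates a 1-cycle in $H_1(G;\mathbb Z)$, in which that edge has coefficient $1$; let $\sigma_1,\dots,\sigma_g$ be these fundamental 1-cycles. For each vertex $p_i$, let $\gamma_i$ be the unique path in $\mathrm{ST}$ from $q$ to $p_i$, viewed as a 1-chain. Define the cycle-edge incidence matrix $\mathbf C[i,j]=\sigma_i(e_j)$ ($g\times m_G$), the path-edge incidence matrix $\mathbf Y[i,j]=\gamma_i(e_j)$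 ($n_G\times m_G$), the edge length matrix $\mathbf L=\mathrm{diag}(\ell(e_1),\dots,\ell(e_{m_G}))$, and $$\mathbf V=\mathbf C\mathbf L\mathbf Y^\top,\qquad \mathbf Q=\mathbf C\mathbf L\mathbf C^\top.$$
   Formalization: The fundamental cycles are kept as the same directed cycles when e is reversed, so if e lies outside the spanning tree its coefficient in its own cycle becomes −1; renormalizing it to 1 would negate a row of V and Q and make the claim false. *)

(* Defs.v *)
From HB Require Import structures.
From mathcomp Require Import all_boot all_order all_algebra.
From mathcomp Require Import boolp classical_sets reals topology.

Set Implicit Arguments.
Unset Strict Implicit.
Unset Printing Implicit Defensive.

Import Order.TTheory GRing.Theory Num.Theory.
Local Open Scope ring_scope.

(* A combinatorial graph with n.+1 vertices, labelled by 'I_n.+1 (so that the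
   root q is ord0), and m edges, labelled by 'I_m. *)
Record cgraph (n m : nat) := CGraph {
  init : 'I_m -> 'I_n.+1;
  term : 'I_m -> 'I_n.+1 }.

(* m_G - n_G + 1; the subtraction does not truncate when G is connected. *)
Definition genus (n m : nat) (G : cgraph n m) : nat := (m + 1 - n.+1)%N.

(* A loop counts twice. *)
Definition valence (n m : nat) (G : cgraph n m) (v : 'I_n.+1) : nat :=
  (#|[set e : 'I_m | init G e == v]| + #|[set e : 'I_m | term G e == v]|)%N.

Definition reorient (n m : nat) (G : cgraph n m) (e : 'I_m) : cgraph n m :=
  CGraph (fun f => if f == e then term G f else init G f)
         (fun f => if f == e then init G f else term G f).

(* A dart (e, b) is the edge e with a direction of traversal: from e_- to e_+
   if b = true, from e_+ to e_- if b = false. *)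
Definition dart (m : nat) : Type := ('I_m * bool)%type.

Definition dart_src (n m : nat) (G : cgraph n m) (d : dart m) : 'I_n.+1 :=
  if d.2 then init G d.1 else term G d.1.

Definition dart_tgt (n m : nat) (G : cgraph n m) (d : dart m) : 'I_n.+1 :=
  if d.2 then term G d.1 else init G d.1.

(* The dart of [reorient G e] that is the same directed edge as the dart d of
   G.  Reorienting an edge f outside the spanning tree keeps the fundamental
   cycle through f as a directed cycle, so that its coefficient at f becomes -1;
   normalizing that coefficient to 1 again would reverse the cycle. *)
Definition reorient_dart (m : nat) (e : 'I_m) (d : dart m) : dart m :=
  (d.1, if d.1 == e then ~~ d.2 else d.2).

Fixpoint is_walk (n m : nat) (G : cgraph n m) (u : 'I_n.+1)
    (w : seq (dart m)) (v : 'I_n.+1) : bool :=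
  if w is d :: w' then (dart_src G d == u) && is_walk G (dart_tgt G d) w' v
  else u == v.

Definition walk_in (m : nat) (T : {set 'I_m}) (w : seq (dart m)) : bool :=
  all (fun d => d.1 \in T) w.

Definition is_path (n m : nat) (G : cgraph n m) (u : 'I_n.+1)
    (w : seq (dart m)) (v : 'I_n.+1) : bool :=
  is_walk G u w v && uniq (u :: map (dart_tgt G) w).

(* Distinctness of the edges excludes traversing one edge back and forth. *)
Definition is_circuit (n m : nat) (G : cgraph n m) (u : 'I_n.+1)
    (w : seq (dart m)) : bool :=
  [&& w != [::], is_walk G u w u, uniq (map (dart_tgt G) w)
    & uniq (map fst w)].

Definition connected_by (n m : nat) (G : cgraph n m) (T : {set 'I_m}) : Prop :=
  forall u v : 'I_n.+1, exists w, is_walk G u w v /\ walk_in T w.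

Definition connected_graph (n m : nat) (G : cgraph n m) : Prop :=
  connected_by G [set: 'I_m].

Definition spanning_tree (n m : nat) (G : cgraph n m) (T : {set 'I_m}) : Prop :=
  connected_by G T /\
  forall (u : 'I_n.+1) (w : seq (dart m)), walk_in T w -> ~~ is_circuit G u w.

(* Integral 1-chains: alpha 0 e is the coefficient of alpha at e. *)
Definition chain (m : nat) : Type := 'rV[int]_m.

Definition dart_sign (m : nat) (d : dart m) : int := if d.2 then 1 else -1.

Definition chain_of_walk (m : nat) (w : seq (dart m)) : chain m :=
  \row_e \sum_(d <- w | d.1 == e) dart_sign d.

Definition is_cycle (n m : nat) (G : cgraph n m) (alpha : chain m) : Prop :=
  forall v : 'I_n.+1,
    \sum_(e | term G e == v) alpha 0 e = \sum_(e | init G e == v) alpha 0 e.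

(* The fundamental cycle obtained by adding the edge d.1 to T, and traversing
   that edge in the direction given by d: the coefficient at d.1 is 1 when
   d.2 = true. *)
Definition is_fundamental_cycle (n m : nat) (G : cgraph n m) (T : {set 'I_m})
    (d : dart m) (sigma : chain m) : Prop :=
  [/\ is_cycle G sigma,
      forall e, e \notin d.1 |: T -> sigma 0 e = 0
    & sigma 0 d.1 = dart_sign d].

Definition fundamental_cycle (n m : nat) (G : cgraph n m) (T : {set 'I_m})
    (d : dart m) : chain m :=
  xget (0 : 'rV[int]_m) (is_fundamental_cycle G T d).

Definition is_tree_path (n m : nat) (G : cgraph n m) (T : {set 'I_m})
    (v : 'I_n.+1) (gamma : chain m) : Prop :=
  exists w : seq (dart m),
    [/\ is_path G ord0 w v, walk_in T w & gamma = chain_of_walk w].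

Definition tree_path (n m : nat) (G : cgraph n m) (T : {set 'I_m})
    (v : 'I_n.+1) : chain m :=
  xget (0 : 'rV[int]_m) (is_tree_path G T v).

Definition enumerates_complement (g m : nat) (T : {set 'I_m})
    (f : 'I_g -> 'I_m) : Prop :=
  injective f /\ forall e : 'I_m, e \notin T <-> exists i, f i = e.

Section Matrices.
Context {R : realType} {n m : nat}.

(* d lists the edges outside T, each with the direction in which its
   fundamental cycle traverses it. *)
Definition cycle_edge_mx (G : cgraph n m) (T : {set 'I_m})
    (d : 'I_(genus G) -> dart m) : 'M[R]_(genus G, m) :=
  \matrix_(i, j) (fundamental_cycle G T (d i) 0 j)%:~R.

Definition path_edge_mx (G : cgraph n m) (T : {set 'I_m}) : 'M[R]_(n.+1, m) :=
  \matrix_(i, j) (tree_path G T i 0 j)%:~R.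

Definition length_mx (ell : 'I_m -> R) : 'M[R]_m := diag_mx (\row_j ell j).

Definition V_mx (G : cgraph n m) (ell : 'I_m -> R) (T : {set 'I_m})
    (d : 'I_(genus G) -> dart m) : 'M[R]_(genus G, n.+1) :=
  cycle_edge_mx T d *m length_mx ell *m (path_edge_mx G T)^T.

Definition Q_mx (G : cgraph n m) (ell : 'I_m -> R) (T : {set 'I_m})
    (d : 'I_(genus G) -> dart m) : 'M[R]_(genus G) :=
  cycle_edge_mx T d *m length_mx ell *m (cycle_edge_mx T d)^T.

End Matrices.

Arguments V_mx {R n m} G ell T d.
Arguments Q_mx {R n m} G ell T d.

Section MetricGraph.
Context {R : realType} {n m : nat}.
Variables (G : cgraph n m) (ell : 'I_m -> R).

(* The disjoint union of the intervals [0, ell e]. *)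
Definition in_edge (x : 'I_m * R) : Prop := 0 <= x.2 <= ell x.1.

Definition lies_at (x : 'I_m * R) (v : 'I_n.+1) : Prop :=
  (x.2 = 0 /\ init G x.1 = v) \/ (x.2 = ell x.1 /\ term G x.1 = v).

(* joined x y r: one can go from x to y in the glued space by finitely many
   moves inside edges, of total length r. *)
Inductive joined : 'I_m * R -> 'I_m * R -> R -> Prop :=
| joined_glue (v : 'I_n.+1) (x y : 'I_m * R) :
    lies_at x v -> lies_at y v -> joined x y 0
| joined_edge (e : 'I_m) (s t : R) :
    in_edge (e, s) -> in_edge (e, t) -> joined (e, s) (e, t) `|s - t|
| joined_trans (x y z : 'I_m * R) (a b : R) :
    joined x y a -> joined y z b -> joined x z (a + b).

Definition glued_dist (x y : 'I_m * R) : R := inf (joined x y).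

(* Gamma is isometric to the quotient, by the gluing at the vertices, of the
   disjoint union of the intervals.  As every vertex is an end of some edge, no
   isolated vertices need to be added. *)
Definition combinatorial_model (Gamma : metricType R) : Prop :=
  (forall e, 0 < ell e) /\
  exists pi : 'I_m * R -> Gamma,
    (forall p, exists2 x, in_edge x & pi x = p) /\
    (forall x y, in_edge x -> in_edge y ->
       mdist (pi x) (pi y) = glued_dist x y).

End MetricGraph.

(* Main.v *)
(** Reorienting [e] multiplies the incidence matrix of [G] on the left by the
    diagonal matrix [S] with entry -1 at [e] and 1 elsewhere.  Hence every
    fundamental cycle and every tree path gets multiplied by [S] on the right,
    so that [C L Y^T] becomes [C S L S Y^T = C L Y^T], and likewise for [Q].
    Both kinds of chains are determined by their boundary up to a cycle
    supported on the spanning tree.  Such a cycle vanishes: the tree has at most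
    [n] edges, while connectedness makes their boundaries span a space of
    dimension at least [n]. *)
Require Import Defs.
From HB Require Import structures.
From mathcomp Require Import all_boot all_order all_algebra.
From mathcomp Require Import boolp classical_sets reals topology.

(** * Transport of choices; the incidence and sign matrices *)

Section Reorientation.
Set Implicit Arguments.
Unset Strict Implicit.
Unset Printing Implicit Defensive.
Import Order.TTheory GRing.Theory Num.Theory.
Local Open Scope ring_scope.

(** [xget] makes an arbitrary choice, which [phi] need not respect; uniqueness forces it to. If [P]
    is empty, so is [Q], and both sides reduce to the default [x0], which [phi] fixes. *)
Lemma xget_involutive (T : choiceType) (x0 : T) (P Q : set T) (phi : T -> T) :
  involutive phi -> phi x0 = x0 -> (forall x, Q (phi x) <-> P x) ->
  (forall x y, P x -> P y -> x = y) -> xget x0 Q = phi (xget x0 P).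
Proof.
move=> phiK phi0 QP Puniq; case: xgetP => [y _ Qy | noQ].
  have Py : P (phi y) by apply/QP; rewrite phiK.
  by rewrite (Puniq _ _ (xgetPex x0 (ex_intro _ _ Py)) Py) phiK.
by case: xgetP => [x _ /QP/noQ | _].
Qed.

(** Rows are edges, so right multiplication takes a chain to its boundary. Taking the difference of
    two indicators gives a loop the zero row. *)
Definition incidence_mx (A : nzRingType) (n m : nat) (G : cgraph n m) :
    'M[A]_(m, n.+1) :=
  \matrix_(e, v) ((term G e == v)%:R - (init G e == v)%:R).

Definition reorient_mx (A : nzRingType) (m : nat) (e : 'I_m) : 'M[A]_m :=
  diag_mx (\row_j (if j == e then -1 else 1)).

Lemma reorient_mxK (A : nzRingType) (m : nat) (e : 'I_m) :
  reorient_mx A e *m reorient_mx A e = 1%:M.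
Proof.
rewrite mulmx_diag -diag_const_mx; congr diag_mx; apply/rowP=> j.
by rewrite !mxE; case: (j == e); rewrite ?mulrNN mulr1.
Qed.

Lemma mulmx_reorientE (A : nzRingType) (p m : nat) (e : 'I_m)
    (M : 'M[A]_(p, m)) i j :
  (M *m reorient_mx A e) i j = if j == e then - M i j else M i j.
Proof. by rewrite mul_mx_diag !mxE; case: (j == e); rewrite ?mulrN mulr1. Qed.

Lemma mulmx_reorientK (A : nzRingType) (p m : nat) (e : 'I_m) :
  involutive (fun M : 'M[A]_(p, m) => M *m reorient_mx A e).
Proof. by move=> M; rewrite -mulmxA reorient_mxK mulmx1. Qed.

(** * Rank of the incidence matrix and rigidity of chains on a tree *)

Section Graph.
Variables (n m : nat) (G : cgraph n m).
Implicit Types (alpha : chain m) (T : {set 'I_m}) (w : seq (dart m)).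

Lemma incidence_mx_reorient (A : nzRingType) (e : 'I_m) :
  incidence_mx A (reorient G e) = reorient_mx A e *m incidence_mx A G.
Proof.
apply/matrixP=> j v; rewrite mul_diag_mx !mxE /=.
by case: (j == e); rewrite ?mulN1r ?opprB ?mul1r.
Qed.

Lemma is_cycleP alpha : is_cycle G alpha <-> alpha *m incidence_mx int G = 0.
Proof.
have E v : (alpha *m incidence_mx int G) 0 v
    = \sum_(e | term G e == v) alpha 0 e - \sum_(e | init G e == v) alpha 0 e.
  rewrite !mxE [in RHS]big_mkcond [X in _ - X]big_mkcond -sumrB.
  apply: eq_bigr => e _; rewrite mxE mulrBr.
  by do 2!case: eqP; rewrite ?mulr1 ?mulr0.
split=> [cyc | /rowP cyc v].
  by apply/rowP=> v; rewrite E cyc subrr mxE.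
by apply/eqP; rewrite -subr_eq0 -E cyc mxE.
Qed.

Lemma row_incidence_mx (A : nzRingType) (e : 'I_m) :
  row e (incidence_mx A G)
  = delta_mx 0 (term G e) - delta_mx 0 (init G e) :> 'rV[A]_n.+1.
Proof. by apply/rowP=> v; rewrite !mxE eqxx /= ![v == _]eq_sym. Qed.

(** Walks in [T] put every difference of two vertex vectors into the row space. The coefficients are
    rational so that rank is available. *)
Lemma connected_incidence_full (T : {set 'I_m}) : connected_by G T ->
  (n <= \rank (rowsub (@enum_val _ (mem T)) (incidence_mx rat G)))%N.
Proof.
move=> connT; set B := rowsub _ _.
have edgeB e : e \in T ->
    ((delta_mx 0 (term G e) - delta_mx 0 (init G e) : 'rV[rat]_n.+1)%R <= B)%MS.
  move=> eT; rewrite -row_incidence_mx.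
  have -> : row e (incidence_mx rat G) = row (enum_rank_in eT e) B.
    by rewrite row_rowsub enum_rankK_in.
  exact: row_sub.
have walkB w u v : is_walk G u w v -> walk_in T w ->
    ((delta_mx 0 v - delta_mx 0 u : 'rV[rat]_n.+1)%R <= B)%MS.
  elim: w u => [|[e b] w IHw] u /=; first by move/eqP->; rewrite subrr sub0mx.
  case/andP=> /eqP <- /IHw{}IHw /andP[/edgeB eB /IHw{IHw} wB].
  (* Telescope through the target of the first dart; a backward dart contributes the opposite of a
     row. *)
  rewrite -(subrK (delta_mx 0 (dart_tgt G (e, b))) (delta_mx 0 v)) -addrA.
  apply: addmx_sub wB _; case: b; first exact: eB.
  by rewrite -opprB eqmx_opp.
(* Adjoining the root vector yields all [n.+1] vertex vectors and raises the rank by at most one. *)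
have full : (1%:M <= B + delta_mx (0 : 'I_1) (ord0 : 'I_n.+1))%MS.
  apply/row_subP=> v; rewrite row1.
  rewrite -(subrK (delta_mx 0 ord0) (delta_mx 0 v)).
  have [w [Gw Tw]] := connT ord0 v.
  exact: addmx_sub_adds (walkB _ _ _ Gw Tw) (submx_refl _).
have := leq_trans (mxrankS full) (mxrank_adds_leqif _ _).
by rewrite mxrank1 mxrank_delta addn1.
Qed.

(** The incidence rows of [T] number at most [n] and have rank at least [n], so they are
    independent; a cycle supported on [T] is a linear relation among them. *)
Lemma tree_cycle_eq0 T alpha : connected_by G T -> (#|T| <= n)%N ->
  is_cycle G alpha -> (forall e, e \notin T -> alpha 0 e = 0) -> alpha = 0.
Proof.
move=> connT cardT /is_cycleP cyc supp.
set B := rowsub (@enum_val _ (mem T)) (incidence_mx rat G).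
have freeB : row_free B.
  by rewrite -row_leq_rank (leq_trans cardT) ?connected_incidence_full.
pose a : 'rV[rat]_#|T| := \row_k (alpha 0 (enum_val k))%:~R.
have aB : a *m B = 0.
  apply/rowP=> v; rewrite !mxE.
  have /rowP/(_ v)/(congr1 (intr : int -> rat)) := cyc.
  rewrite !mxE rmorph_sum rmorph0 => cycv; apply: etrans cycv.
  rewrite [RHS](bigID (mem T)) /= [X in _ + X]big1 ?addr0; last first.
    by move=> e /supp ->; rewrite mul0r.
  rewrite [RHS]big_enum_val; apply: eq_bigr => k _.
  by rewrite !mxE rmorphM rmorphB /= !natz.
have /rowP a0 : a = 0 by apply/eqP; rewrite -(mulmx_free_eq0 _ freeB) aB.
apply/rowP=> e; rewrite mxE; have [eT|/supp//] := boolP (e \in T).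
have /eqP := a0 (enum_rank_in eT e).
by rewrite !mxE enum_rankK_in // intr_eq0 => /eqP.
Qed.

(** Agreement off [T], instead of vanishing there, covers both fundamental cycles, which may use one
    further edge, and tree paths. *)
Lemma tree_chain_eq T alpha beta : connected_by G T -> (#|T| <= n)%N ->
  alpha *m incidence_mx int G = beta *m incidence_mx int G ->
  (forall e, e \notin T -> alpha 0 e = beta 0 e) -> alpha = beta.
Proof.
move=> connT cardT bd supp; apply/eqP; rewrite -subr_eq0; apply/eqP.
apply: (tree_cycle_eq0 connT cardT) => [|e /supp eq_e].
  by apply/is_cycleP; rewrite mulmxBl bd subrr.
by rewrite !mxE eq_e subrr.
Qed.

Lemma fundamental_cycle_uniq T d alpha beta :
  connected_by G T -> (#|T| <= n)%N ->
  is_fundamental_cycle G T d alpha -> is_fundamental_cycle G T d beta ->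
  alpha = beta.
Proof.
move=> connT cardT [/is_cycleP cyca suppa ad] [/is_cycleP cycb suppb bd].
apply: (tree_chain_eq connT cardT) => [|e eT]; first by rewrite cyca cycb.
have [-> | ne] := eqVneq e d.1; first by rewrite ad bd.
by rewrite suppa ?suppb // !inE negb_or ne.
Qed.

(** * Boundaries of walks and uniqueness of tree paths *)

Lemma chain_of_walk_cons d w :
  chain_of_walk (d :: w) = dart_sign d *: delta_mx 0 d.1 + chain_of_walk w.
Proof.
apply/rowP=> e; rewrite !mxE big_cons eqxx /= [e == _]eq_sym.
by case: eqP; rewrite ?mulr1 ?mulr0 ?add0r.
Qed.

Lemma boundary_walk u w v : is_walk G u w v ->
  chain_of_walk w *m incidence_mx int G = delta_mx 0 v - delta_mx 0 u.
Proof.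
elim: w u => [|[e b] w IHw] u /=.
  move/eqP->; rewrite subrr (_ : chain_of_walk [::] = 0) ?mul0mx //.
  by apply/rowP=> j; rewrite !mxE big_nil.
case/andP=> /eqP <- /IHw{}IHw; rewrite chain_of_walk_cons mulmxDl IHw.
rewrite -scalemxAl -rowE row_incidence_mx.
by case: b {IHw} => /=; rewrite ?scale1r ?scaleN1r ?opprB addrC subrKA.
Qed.

Lemma chain_of_walk_supp T w e :
  walk_in T w -> e \notin T -> chain_of_walk w 0 e = 0.
Proof.
move=> /allP Tw eT; rewrite mxE big_seq_cond big1 // => d /andP[/Tw dT /eqP de].
by rewrite -de dT in eT.
Qed.

Lemma tree_path_uniq T v alpha beta :
  connected_by G T -> (#|T| <= n)%N ->
  is_tree_path G T v alpha -> is_tree_path G T v beta -> alpha = beta.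
Proof.
move=> connT cardT [w [/andP[Gw _] Tw ->]] [w' [/andP[Gw' _] Tw' ->]].
apply: (tree_chain_eq connT cardT) => [|e eT].
  by rewrite (boundary_walk Gw) (boundary_walk Gw').
by rewrite (chain_of_walk_supp Tw eT) (chain_of_walk_supp Tw' eT).
Qed.

End Graph.

(** * Darts, walks and chains under reorientation *)

Section ReorientedGraph.
Variables (n m : nat) (G : cgraph n m) (e : 'I_m).
Implicit Types (alpha : chain m) (T : {set 'I_m}) (w : seq (dart m)).
Let rd := @reorient_dart m e.

Lemma reorient_dartK : involutive rd.
Proof. by case=> j b; rewrite /rd /reorient_dart /=; case: eqP; rewrite ?negbK. Qed.

Lemma dart_src_reorient d : dart_src (reorient G e) (rd d) = dart_src G d.
Proof. by case: d => j []; rewrite /dart_src /=; case: (j == e). Qed.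

Lemma dart_tgt_reorient d : dart_tgt (reorient G e) (rd d) = dart_tgt G d.
Proof. by case: d => j []; rewrite /dart_tgt /=; case: (j == e). Qed.

Lemma dart_sign_reorient d :
  dart_sign (rd d) = if d.1 == e then - dart_sign d else dart_sign d.
Proof. by case: d => j []; rewrite /dart_sign /=; case: (j == e). Qed.

Lemma is_path_reorient u w v :
  is_path (reorient G e) u (map rd w) v = is_path G u w v.
Proof.
rewrite /is_path -map_comp (eq_map (g := dart_tgt G)) //; last first.
  exact: dart_tgt_reorient.
congr (_ && _); elim: w u => //= d w IHw u.
by rewrite dart_src_reorient dart_tgt_reorient IHw.
Qed.

Lemma chain_of_walk_reorient w :
  chain_of_walk (map rd w) = chain_of_walk w *m reorient_mx int e.
Proof.
apply/rowP=> j; rewrite mulmx_reorientE !mxE big_map -sumrN.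
have [-> | ne] := eqVneq j e.
  by apply: eq_bigr => d /= de; rewrite dart_sign_reorient de.
by apply: eq_bigr => d /= /eqP de; rewrite dart_sign_reorient de (negPf ne).
Qed.

Lemma is_cycle_reorient alpha :
  is_cycle (reorient G e) (alpha *m reorient_mx int e) <-> is_cycle G alpha.
Proof.
by split=> /is_cycleP cyc; apply/is_cycleP; move: cyc;
  rewrite incidence_mx_reorient mulmxA mulmx_reorientK.
Qed.

(** The prescribed coefficient at [d.1] and the actual one change sign together, exactly when [d.1]
    is [e]. *)
Lemma is_fundamental_cycle_reorient T d alpha :
  is_fundamental_cycle (reorient G e) T (rd d) (alpha *m reorient_mx int e)
  <-> is_fundamental_cycle G T d alpha.
Proof.
rewrite /is_fundamental_cycle dart_sign_reorient mulmx_reorientE.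
split=> -[cyc supp val_d]; split.
- exact/is_cycle_reorient.
- move=> j /supp; rewrite mulmx_reorientE.
  by case: ifP => // _ /eqP; rewrite oppr_eq0 => /eqP.
- by move: val_d => /=; case: ifP => // _ /oppr_inj.
- exact/is_cycle_reorient.
- by move=> j /supp; rewrite mulmx_reorientE => ->; rewrite oppr0 if_same.
- by rewrite /= val_d.
Qed.

Lemma is_tree_path_reorient T v alpha :
  is_tree_path (reorient G e) T v (alpha *m reorient_mx int e)
  <-> is_tree_path G T v alpha.
Proof.
have walk_rd w : walk_in T (map rd w) = walk_in T w by rewrite /walk_in all_map.
(* The same witness serves both directions because [rd] is an involution. *)
split=> -[w [Gw Tw Ew]]; exists (map rd w).
  split; rewrite ?walk_rd //; last first.
    by rewrite chain_of_walk_reorient -Ew mulmx_reorientK.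
  by rewrite -is_path_reorient (mapK reorient_dartK).
by rewrite is_path_reorient walk_rd chain_of_walk_reorient Ew.
Qed.

(** * The chosen cycles and paths, and the matrices built from them *)

Lemma fundamental_cycle_reorient T d : connected_by G T -> (#|T| <= n)%N ->
  fundamental_cycle (reorient G e) T (rd d)
  = fundamental_cycle G T d *m reorient_mx int e.
Proof.
move=> connT cardT.
apply: (xget_involutive (@mulmx_reorientK int 1 m e)); first exact: mul0mx.
  exact: is_fundamental_cycle_reorient.
by move=> alpha beta; apply: fundamental_cycle_uniq.
Qed.

Lemma tree_path_reorient T v : connected_by G T -> (#|T| <= n)%N ->
  tree_path (reorient G e) T v = tree_path G T v *m reorient_mx int e.
Proof.
move=> connT cardT.
apply: (xget_involutive (@mulmx_reorientK int 1 m e)); first exact: mul0mx.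
  exact: is_tree_path_reorient.
by move=> alpha beta; apply: tree_path_uniq.
Qed.

(** The two sides have the same type because [genus] depends only on [n] and [m], hence is unchanged
    by definition. *)
Lemma cycle_edge_mx_reorient (R : realType) T (d : 'I_(genus G) -> dart m) :
  connected_by G T -> (#|T| <= n)%N ->
  cycle_edge_mx (R := R) (G := reorient G e) T (fun i => rd (d i))
  = cycle_edge_mx T d *m reorient_mx R e.
Proof.
move=> connT cardT; apply/matrixP=> i j; rewrite mulmx_reorientE !mxE.
rewrite fundamental_cycle_reorient // mulmx_reorientE.
by case: (j == e); rewrite ?rmorphN.
Qed.

Lemma path_edge_mx_reorient (R : realType) T :
  connected_by G T -> (#|T| <= n)%N ->
  path_edge_mx (reorient G e) T = path_edge_mx G T *m reorient_mx R e.
Proof.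
move=> connT cardT; apply/matrixP=> i j; rewrite mulmx_reorientE !mxE.
rewrite tree_path_reorient // mulmx_reorientE.
by case: (j == e); rewrite ?rmorphN.
Qed.

(** The sign matrix is diagonal, so it is symmetric and commutes with the length matrix; its two
    copies then meet and cancel. *)
Lemma length_form_reorient (R : realType) (ell : 'I_m -> R) p q
    (A : 'M[R]_(p, m)) (B : 'M[R]_(q, m)) :
  A *m reorient_mx R e *m length_mx ell *m (B *m reorient_mx R e)^T
  = A *m length_mx ell *m B^T.
Proof.
rewrite trmx_mul tr_diag_mx -!mulmxA; congr (A *m _).
have comm_LS : length_mx ell *m reorient_mx R e
    = reorient_mx R e *m length_mx ell by exact: diag_mxC.
by rewrite (mulmxA (length_mx ell)) comm_LS -!mulmxA mulmxA reorient_mxK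
  mul1mx.
Qed.

End ReorientedGraph.

(* The truncation in [genus] is harmless: if [m < n] then [T] still has at most
   [m] edges. *)
Lemma card_tree_le (n m : nat) (G : cgraph n m) (T : {set 'I_m})
    (f : 'I_(genus G) -> 'I_m) : enumerates_complement T f -> (#|T| <= n)%N.
Proof.
case=> f_inj f_im.
have cardTC : #|~: T| = genus G.
  rewrite -[RHS]card_ord -(card_imset _ f_inj); apply: eq_card => j.
  rewrite !inE; apply/idP/imsetP=> [/f_im[i <-] | [i _ ->]]; first by exists i.
  by apply/f_im; exists i.
have := cardsC T; rewrite cardTC card_ord /genus addn1 subSS => cardT.
(* Here [cardT] reads [#|T| + (m - n) = m] with truncated subtraction, so what remains is
   [m <= n + (m - n)]. *)
by rewrite -(leq_add2r (m - n)) cardT -leq_subLR.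
Qed.

End Reorientation.

Theorem proposition4p4 (R : realType) (Gamma : metricType R) (n m : nat)
    (G : cgraph n m) (ell : 'I_m -> R)
    (G_connected : connected_graph G)
    (G_valence : forall v : 'I_n.+1, 2 <= valence G v)
    (G_model : combinatorial_model G ell Gamma)
    (ST : {set 'I_m}) (ST_tree : spanning_tree G ST)
    (f : 'I_(genus G) -> 'I_m) (f_enum : enumerates_complement ST f)
    (e : 'I_m) :
  let d := fun i => (f i, true) in
  V_mx (reorient G e) ell ST (fun i => reorient_dart e (d i))
    = V_mx G ell ST d /\
  Q_mx (reorient G e) ell ST (fun i => reorient_dart e (d i))
    = Q_mx G ell ST d.
Proof.
(* The bound on the size of [ST] comes from [f], which lists exactly [genus G] edges outside it. *)
have [connT _] := ST_tree; have cardT := card_tree_le f_enum.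
rewrite /V_mx /Q_mx cycle_edge_mx_reorient // path_edge_mx_reorient //.
by rewrite !length_form_reorient.
Qed.
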